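(* For every affine map $\phi(w)=aw+b$ with $a>0$ and $b\in\mathbb{C}$, $\mathrm{Re}(b)\geq 0$, the composition operator $C_{\phi}f=f\circ\phi$ is not Li-Yorke chaotic on $H^2(\mathbb{C}_{+})$.
   Context: $\mathbb{C}_{+}=\{w\in\mathbb{C}:\mathrm{Re}(w)>0\}$. $H^2(\mathbb{C}_{+})$ is the Hardy space of holomorphic $f$ on $\mathbb{C}_{+}$ with finite norm $\|f\|_2^2=\sup_{0<x<\infty}\frac{1}{\pi}\int_{-\infty}^{\infty}|f(x+iy)|^2\,dy$; $C_\phi$ is bounded on it. An operator $T$ on a Banach space $X$ is Li-Yorke chaotic if there is an uncountable set $S\subset X$ such that for all $x,y\in S$ with $x\neq y$: $\liminf_{n\to\infty}\|T^nx-T^ny\|=0$ and $\limsup_{n\to\infty}\|T^nx-T^ny\|>0$. *)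

(* Defs.v *)
From mathcomp Require Import all_boot all_order all_algebra.
From mathcomp Require Import all_classical all_reals all_analysis.
From mathcomp Require Export complex.
Import Order.TTheory GRing.Theory Num.Theory.
Import numFieldNormedType.Exports.

Set Implicit Arguments.
Unset Strict Implicit.
Unset Printing Implicit Defensive.

Local Open Scope ring_scope.
Local Open Scope classical_set_scope.

Definition rhp (R : realType) : set R[i] := [set w | 0 < complex.Re w].

(* f is holomorphic on C_+ : complex-differentiable at every point of C_+
   (derivative along 1 with scalars in R[i], i.e. the limit of
   (f (w + h) - f w) / h as the complex h -> 0, h <> 0). *)
Definition holomorphic_on_rhp (R : realType) (f : R[i] -> R[i]) : Prop :=
  forall w : R[i], @rhp R w -> derivable (f : (R[i])^o -> (R[i])^o) w 1.

Definition h2_sqnorm (R : realType) (f : R[i] -> R[i]) : \bar R :=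
  ereal_sup [set ((pi^-1)%:E *
      \int[@lebesgue_measure R]_(y in [set: R])
         ((ComplexField.Normc.normc (f (Complex x y))) ^+ 2)%:E)%E
    | x in [set x : R | 0 < x]].

Definition in_H2 (R : realType) (f : R[i] -> R[i]) : Prop :=
  holomorphic_on_rhp f /\ (h2_sqnorm f < +oo)%E.

(* The H^2 norm ||f||_2 (meaningful for f in H^2). *)
Definition h2_norm (R : realType) (f : R[i] -> R[i]) : R :=
  Num.sqrt (fine (h2_sqnorm f)).

Definition comp_op (R : realType) (phi : R[i] -> R[i]) (f : R[i] -> R[i]) :
  R[i] -> R[i] := f \o phi.

(* Li-Yorke chaos of an operator T on a normed space given by its carrier
   X (a subset of a zmodType V) and its norm nrm. *)
Definition li_yorke_chaotic (R : realType) (V : zmodType) (X : set V)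
    (nrm : V -> R) (T : V -> V) : Prop :=
  exists S : set V, S `<=` X /\ ~ countable S /\
    forall x y, S x -> S y -> x <> y ->
      limn_einf (fun n => (nrm (iter n T x - iter n T y))%:E) = 0%E /\
      (0 < limn_esup (fun n => (nrm (iter n T x - iter n T y))%:E))%E.

(* Main.v *)
(** A difference [g] of two members of a scrambled set is analysed along the
    norms [u n] of [T^n g]. The affine substitution gives
    [tail (T f) B = a^-1 * tail f (a B + Re b)], where [tail f B] is the supremum
    of the mean squares of [f] over the vertical lines [Re = x] with [x > B], so
    that [tail f 0] is the squared norm.
    If [a >= 1] then [u] is nonincreasing and its limits inferior and superior
    agree. If [a < 1], let [B = Re b / (1 - a)] be the fixed point of
    [B |-> a B + Re b]. Either [tail g B > 0], and [u] is bounded below because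
    [tail (T^n g) B = a^-n * tail g B], or [g] vanishes on [Re > B], hence on the
    whole half-plane by the identity principle, and [u = 0].
    The identity principle is obtained without Cauchy's formula: Goursat's theorem
    is applied to [f(z) (1 + ((z - w) / L)^2)^n] on a rectangle whose left side is
    centred at [w] and whose right side lies in the region where [f = 0]. The
    horizontal sides contribute [O((9/16)^n)], while on the left side the kernel is
    real and concentrates at [w], so [f w = 0]. *)
Require Import Defs.
From mathcomp Require Import all_boot all_order all_algebra.
From mathcomp Require Import all_classical all_reals all_analysis.
From mathcomp Require Import measurable_realfun complex ring lra.
Import Order.TTheory GRing.Theory Num.Theory.
Import numFieldNormedType.Exports.
Set Implicit Arguments.
Unset Strict Implicit.
Unset Printing Implicit Defensive.
Local Open Scope ring_scope.
Local Open Scope classical_set_scope.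

(** * Integrals of real functions over a segment *)

Section integral_on_segment.
Variable R : realType.
Implicit Types (a b c e m M : R) (g h : R -> R).

Definition integrable_on a b h :=
  (@lebesgue_measure R).-integrable `[a, b] (EFin \o h).

Definition segint a b h : R := (\int[@lebesgue_measure R]_(x in `[a, b]) h x)%R.

Lemma continuous_integrable_on a b h :
  (forall t, a <= t <= b -> forall e, 0 < e -> exists2 d, 0 < d &
     forall s, a <= s <= b -> `|s - t| < d -> `|h s - h t| < e) ->
  integrable_on a b h.
Proof.
move=> ch; apply: continuous_compact_integrable; first exact: segment_compact.
apply/subspace_continuousP => t; rewrite /= in_itv /= => tab.
apply/cvgrPdist_lt => e e0; have [d d0 hd] := ch t tab e e0.
rewrite near_withinE; near=> s => /=; rewrite in_itv /= => sab.
rewrite distrC; apply: hd => //; rewrite distrC; near: s.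
Unshelve. all: end_near. Qed.

Lemma integrable_onS a b c e h : a <= c -> e <= b ->
  integrable_on a b h -> integrable_on c e h.
Proof.
move=> ac eb; apply: integrableS => //.
by move=> x /=; rewrite !in_itv /= => /andP[cx xe]; rewrite (le_trans ac) ?(le_trans xe).
Qed.

Lemma integrable_onB a b g h : integrable_on a b g -> integrable_on a b h ->
  integrable_on a b (fun x => g x - h x).
Proof. by move=> ig ih; exact: (integrableB _ ig ih). Qed.

Lemma integrable_on_cst a b c : integrable_on a b (fun=> c).
Proof.
apply: continuous_integrable_on => t _ e e0.
by exists 1 => // s _ _; rewrite subrr normr0.
Qed.

Lemma segintB a b g h : integrable_on a b g -> integrable_on a b h ->
  segint a b (fun x => g x - h x) = segint a b g - segint a b h.
Proof. by move=> ig ih; exact: RintegralB. Qed.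

Lemma segint_cst a b c : a <= b -> segint a b (fun=> c) = c * (b - a).
Proof.
move=> ab; rewrite /segint Rintegral_cst //= lebesgue_measure_itv /= lte_fin.
by move: ab; rewrite le_eqVlt => /predU1P[->|->//]; rewrite ltxx subrr.
Qed.

Lemma segint_split a b c h : a <= c -> c <= b -> integrable_on a b h ->
  segint a b h = segint a c h + segint c b h.
Proof.
move=> ac cb ih; apply/eqP; rewrite addrC -subr_eq; apply/eqP.
rewrite /segint Rintegral_itvB ?bnd_simp// Rintegral_itv_obnd_cbnd //.
apply: integrableS ih => //.
by move=> x /=; rewrite !in_itv /= => /andP[cx ->]; rewrite (le_trans ac) ?(ltW cx).
Qed.

Lemma segint_ge a b m h : a <= b -> integrable_on a b h ->
  (forall t, a <= t <= b -> m <= h t) -> m * (b - a) <= segint a b h.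
Proof.
move=> ab ih mh; rewrite -segint_cst //; apply: le_Rintegral => //; exact: integrable_on_cst.
Qed.

Lemma segint_le a b m h : a <= b -> integrable_on a b h ->
  (forall t, a <= t <= b -> h t <= m) -> segint a b h <= m * (b - a).
Proof.
move=> ab ih mh; rewrite -segint_cst //; apply: le_Rintegral => //; exact: integrable_on_cst.
Qed.

Lemma segint_near_cst a b c e h : a <= b -> integrable_on a b h ->
  (forall t, a <= t <= b -> `|h t - c| <= e) ->
  `|segint a b h - c * (b - a)| <= e * (b - a).
Proof.
move=> ab ih hc; rewrite ler_norml lerBrDr lerBlDr -mulNr -!mulrDl.
by rewrite segint_ge ?segint_le // => t /hc; rewrite ler_norml => /andP[]; lra.
Qed.

End integral_on_segment.

(** * Goursat's theorem for a real one-form on a rectangle *)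

Lemma nested_segments (R : realType) (u v : nat -> R) :
  (forall n, u n <= u n.+1) -> (forall n, v n.+1 <= v n) ->
  (forall n, u n <= v n) -> exists x, forall n, u n <= x <= v n.
Proof.
move=> /nondecreasing_seqP ndu /nonincreasing_seqP niv uv.
have uv' n m : u n <= v m.
  apply: le_trans (ndu _ _ (leq_maxl n m)) _.
  exact: le_trans (uv _) (niv _ _ (leq_maxr n m)).
exists (sup (range u)) => n; apply/andP; split.
  apply: ub_le_sup; last by exists n.
  by exists (v 0%N) => _ [m _ <-].
by apply: ge_sup; [exists (u 0%N); exists 0%N|move=> _ [m _ <-]].
Qed.

(** The expansion with tolerance 1 bounds [|h s - h a|] by [(1 + |p|) * |s - a|] near [a], so [h] is
    continuous on the segment. *)
Lemma differentiable_integrable_on (R : realType) (u v : R) (h : R -> R) :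
  (forall a, u <= a <= v -> exists p, forall e, 0 < e -> exists2 d, 0 < d &
     forall s, u <= s <= v -> `|s - a| < d ->
       `|h s - h a - p * (s - a)| <= e * `|s - a|) ->
  integrable_on u v h.
Proof.
move=> dh; apply: continuous_integrable_on => a ua e e0.
have [p /(_ 1 ltr01)[d d0 hd]] := dh a ua.
exists (Num.min d (e / (1 + `|p|))) => [|s us].
  by rewrite lt_min d0 divr_gt0 // ltr_wpDr.
rewrite lt_min ltr_pdivlMr ?ltr_wpDr // => /andP[sd].
apply: le_lt_trans; rewrite mulrDr mulr1 [_ * `|p|]mulrC -normrM.
rewrite -(subrK (p * (s - a)) (h s - h a)).
by rewrite (le_trans (ler_normD _ _)) // lerD2r -[leRHS]mul1r hd.
Qed.

Section goursat.
Variables (R : realType) (P Q : R -> R -> R).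

(* The circulation of [P dx + Q dy], with opposite sides paired so that only
   differences of [P] and of [Q] are integrated. *)
Definition circulation (x0 x1 y0 y1 : R) : R :=
  segint x0 x1 (fun x => P x y0 - P x y1) +
  segint y0 y1 (fun y => Q x1 y - Q x0 y).

Variables x0 x1 y0 y1 : R.
Let rect (x y : R) := (x0 <= x <= x1) && (y0 <= y <= y1).

(* The shared coefficient [q] expresses [P_y = Q_x]. *)
Definition closed_form_on := forall a b, rect a b ->
  exists p q r : R, forall e, 0 < e -> exists2 d, 0 < d &
  forall x y, rect x y -> `|x - a| < d -> `|y - b| < d ->
   `|P x y - P a b - p * (x - a) - q * (y - b)| <= e * (`|x - a| + `|y - b|) /\
   `|Q x y - Q a b - q * (x - a) - r * (y - b)| <= e * (`|x - a| + `|y - b|).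

Hypothesis PQ : closed_form_on.

Lemma integrable_horizontal u v b : x0 <= u -> v <= x1 -> y0 <= b <= y1 ->
  integrable_on u v (P^~ b).
Proof.
move=> xu vx yb; apply: (integrable_onS xu vx).
apply: differentiable_integrable_on => a xa.
have [|p [q [r h]]] := PQ (a := a) (b := b); first by rewrite /rect xa.
exists p => e /h[d d0 hd]; exists d => // s xs sa.
have [||+ _] := hd s b _ sa; first by rewrite /rect xs.
  by rewrite subrr normr0.
by rewrite subrr mulr0 subr0 normr0 addr0.
Qed.

Lemma integrable_vertical u v a : y0 <= u -> v <= y1 -> x0 <= a <= x1 ->
  integrable_on u v (Q a).
Proof.
move=> yu vy xa; apply: (integrable_onS yu vy).
apply: differentiable_integrable_on => b yb.
have [|p [q [r h]]] := PQ (a := a) (b := b); first by rewrite /rect xa.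
exists r => e /h[d d0 hd]; exists d => // s ys sb.
have [||_] := hd a s _ _ sb; first by rewrite /rect xa.
  by rewrite subrr normr0.
by rewrite subrr mulr0 subr0 normr0 add0r.
Qed.

Lemma circulationE u0 u1 v0 v1 :
  x0 <= u0 -> u0 <= u1 -> u1 <= x1 -> y0 <= v0 -> v0 <= v1 -> v1 <= y1 ->
  circulation u0 u1 v0 v1 = segint u0 u1 (P^~ v0) - segint u0 u1 (P^~ v1) +
    (segint v0 v1 (Q u1) - segint v0 v1 (Q u0)).
Proof.
move=> xu uu ux yv vv vy; congr (_ + _); apply: segintB.
- by apply: integrable_horizontal => //; lra.
- by apply: integrable_horizontal => //; lra.
- by apply: integrable_vertical => //; lra.
- by apply: integrable_vertical => //; lra.
Qed.

Lemma circulation_splitx u0 m u1 v0 v1 :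
  x0 <= u0 -> u0 <= m -> m <= u1 -> u1 <= x1 -> y0 <= v0 -> v0 <= v1 -> v1 <= y1 ->
  circulation u0 u1 v0 v1 = circulation u0 m v0 v1 + circulation m u1 v0 v1.
Proof.
move=> xu um mu ux yv vv vy; rewrite !circulationE //; try lra.
rewrite !(segint_split um mu); first ring.
- by apply: integrable_horizontal => //; lra.
- by apply: integrable_horizontal => //; lra.
Qed.

Lemma circulation_splity u0 u1 v0 m v1 :
  x0 <= u0 -> u0 <= u1 -> u1 <= x1 -> y0 <= v0 -> v0 <= m -> m <= v1 -> v1 <= y1 ->
  circulation u0 u1 v0 v1 = circulation u0 u1 v0 m + circulation u0 u1 m v1.
Proof.
move=> xu uu ux yv vm mv vy; rewrite !circulationE //; try lra.
rewrite !(segint_split vm mv); first ring.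
- by apply: integrable_vertical => //; lra.
- by apply: integrable_vertical => //; lra.
Qed.

(** The linear parts contribute [q * (v0 - v1) * (u1 - u0)] and [q * (u1 - u0) * (v1 - v0)], which
    cancel because [q] is shared. What remains is the error term, at most [2 * e] times the
    half-perimeter on each pair of sides. *)
Lemma circulation_near a b e d p q r u0 u1 v0 v1 :
  x0 <= u0 -> u0 <= a -> a <= u1 -> u1 <= x1 ->
  y0 <= v0 -> v0 <= b -> b <= v1 -> v1 <= y1 ->
  u1 - u0 < d -> v1 - v0 < d -> 0 < e ->
  (forall x y, rect x y -> `|x - a| < d -> `|y - b| < d ->
   `|P x y - P a b - p * (x - a) - q * (y - b)| <= e * (`|x - a| + `|y - b|) /\
   `|Q x y - Q a b - q * (x - a) - r * (y - b)| <= e * (`|x - a| + `|y - b|)) ->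
  `|circulation u0 u1 v0 v1| <= 2 * e * ((u1 - u0) + (v1 - v0)) ^+ 2.
Proof.
move=> xu ua au ux yv vb bv vy ud vd e0 hd.
have uu := le_trans ua au; have vv := le_trans vb bv.
have near x y : u0 <= x <= u1 -> v0 <= y <= v1 ->
   `|P x y - P a b - p * (x - a) - q * (y - b)| <= e * ((u1 - u0) + (v1 - v0)) /\
   `|Q x y - Q a b - q * (x - a) - r * (y - b)| <= e * ((u1 - u0) + (v1 - v0)).
  move=> ux' vy'.
  have xa : `|x - a| <= u1 - u0 by rewrite ler_norml; lra.
  have yb : `|y - b| <= v1 - v0 by rewrite ler_norml; lra.
  have [|||h1 h2] := hd x y; [by rewrite /rect; lra|lra|lra|].
  have hle : e * (`|x - a| + `|y - b|) <= e * ((u1 - u0) + (v1 - v0)).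
    by rewrite ler_pM2l // lerD.
  by split; [exact: le_trans h1 hle|exact: le_trans h2 hle].
have u0u : u0 <= u0 <= u1 by lra.
have u1u : u0 <= u1 <= u1 by lra.
have v0v : v0 <= v0 <= v1 by lra.
have v1v : v0 <= v1 <= v1 by lra.
have hP : `|segint u0 u1 (fun x => P x v0 - P x v1) - q * (v0 - v1) * (u1 - u0)|
    <= 2 * e * ((u1 - u0) + (v1 - v0)) * (u1 - u0).
  apply: segint_near_cst => // [|t tu].
    by apply: integrable_onB; apply: integrable_horizontal => //; lra.
  have [+ _] := near t v0 tu v0v; have [+ _] := near t v1 tu v1v.
  by rewrite !ler_norml; lra.
have hQ : `|segint v0 v1 (fun y => Q u1 y - Q u0 y) - q * (u1 - u0) * (v1 - v0)|
    <= 2 * e * ((u1 - u0) + (v1 - v0)) * (v1 - v0).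
  apply: segint_near_cst => // [|t tv].
    by apply: integrable_onB; apply: integrable_vertical => //; lra.
  have [_ +] := near u0 t u0u tv; have [_ +] := near u1 t u1u tv.
  by rewrite !ler_norml; lra.
rewrite expr2 mulrA mulrDr.
apply: le_trans (lerD hP hQ); apply: le_trans (ler_normD _ _).
by rewrite le_eqVlt; apply/orP; left; apply/eqP; congr `|_|; rewrite /circulation; ring.
Qed.

End goursat.

Section goursat_theorem.
Variables (R : realType) (P Q : R -> R -> R) (x0 x1 y0 y1 : R).
Hypothesis PQ : closed_form_on P Q x0 x1 y0 y1.

Let I (s : R * R * R * R) := circulation P Q s.1.1.1 s.1.1.2 s.1.2 s.2.

Let good (s : R * R * R * R) := 
  [&& x0 <= s.1.1.1, s.1.1.1 <= s.1.1.2, s.1.1.2 <= x1, y0 <= s.1.2,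
      s.1.2 <= s.2 & s.2 <= y1].

(** A rectangle is stored as left, right, bottom, top. Guarding the relation by [good s] makes it
    total, as [dependent_choice] requires. *)
Let child (s t : R * R * R * R) := good s ->
  [/\ good t, (s.1.1.1 <= t.1.1.1) && (t.1.1.2 <= s.1.1.2),
      (s.1.2 <= t.1.2) && (t.2 <= s.2),
      (t.1.1.2 - t.1.1.1 = (s.1.1.2 - s.1.1.1) / 2) *
      (t.2 - t.1.2 = (s.2 - s.1.2) / 2) & `|I s| <= 4 * `|I t|].

Let half_of_sum (s t u : R) : s = t + u -> `|s| <= 2 * `|t| \/ `|s| <= 2 * `|u|.
Proof.
move=> ->; have := ler_normD t u.
by case: (leP `|t| `|u|) => ?; [right|left]; lra.
Qed.

(** Bisect first in [x], then in [y], keeping each time a half that carries at least half of the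
    circulation; the two factors 2 give the 4. *)
Let childP s : exists t, child s t.
Proof.
have [gs|/negP ngs] := boolP (good s); last by exists s => /ngs.
case: s gs => [[[u0 u1] v0] v1]; rewrite /child /good /I /= => gs.
have /and5P[xu uu ux yv /andP[vv vy]] := gs.
set m := (u0 + u1) / 2; set k := (v0 + v1) / 2.
have [w0 [w1 [wu0 wu1 ww hx]]] : exists w0 w1, [/\ u0 <= w0, w1 <= u1,
    w1 - w0 = (u1 - u0) / 2 & `|circulation P Q u0 u1 v0 v1| <=
      2 * `|circulation P Q w0 w1 v0 v1|].
  have sx : circulation P Q u0 u1 v0 v1 = circulation P Q u0 m v0 v1 +
      circulation P Q m u1 v0 v1.
    by apply: (circulation_splitx PQ) => //; rewrite /m; lra.
  have [h|h] := half_of_sum sx.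
  - by exists u0, m; split => //; rewrite /m; lra.
  - by exists m, u1; split => //; rewrite /m; lra.
have [z0 [z1 [zv0 zv1 zz hy]]] : exists z0 z1, [/\ v0 <= z0, z1 <= v1,
    z1 - z0 = (v1 - v0) / 2 & `|circulation P Q w0 w1 v0 v1| <=
      2 * `|circulation P Q w0 w1 z0 z1|].
  have sy : circulation P Q w0 w1 v0 v1 = circulation P Q w0 w1 v0 k +
      circulation P Q w0 w1 k v1.
    by apply: (circulation_splity PQ) => //; rewrite /k; lra.
  have [h|h] := half_of_sum sy.
  - by exists v0, k; split => //; rewrite /k; lra.
  - by exists k, v1; split => //; rewrite /k; lra.
exists (w0, w1, z0, z1) => _ /=; split => //.
- by apply/and5P; split; [..|apply/andP; split]; lra.
- by rewrite wu0.
- by rewrite zv0.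
- lra.
Qed.

(** Repeated bisection yields rectangles shrinking to a point [(a, b)]. The [n]-th one carries at
    least [4^-n] of the total circulation, while differentiability at [(a, b)] makes it an
    arbitrarily small multiple of [4^-n]. *)
Lemma goursat_rectangle : x0 <= x1 -> y0 <= y1 -> circulation P Q x0 x1 y0 y1 = 0.
Proof.
move=> x01 y01.
have [f [f0 fS]] := dependent_choice (fun s => cid (childP s)) (x0, x1, y0, y1).
have gf n : good (f n).
  elim: n => [|n /(fS n)[]//]; by rewrite f0 /good /= !lexx x01 y01.
have fS' n := fS n (gf n).
have [a ha] : exists a, forall n, (f n).1.1.1 <= a <= (f n).1.1.2.
  apply: nested_segments => n.
  - by have [_ /andP[]] := fS' n.
  - by have [_ /andP[]] := fS' n.
  - by have /and5P[] := gf n.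
have [b hb] : exists b, forall n, (f n).1.2 <= b <= (f n).2.
  apply: nested_segments => n.
  - by have [_ _ /andP[]] := fS' n.
  - by have [_ _ /andP[]] := fS' n.
  - by have /and5P[_ _ _ _ /andP[]] := gf n.
have fx n : (f n).1.1.2 - (f n).1.1.1 = (x1 - x0) / 2 ^+ n.
  elim: n => [|n ih]; first by rewrite f0 expr0 divr1.
  by have [_ _ _ [-> _] _] := fS' n; rewrite ih exprSr invfM mulrA.
have fy n : (f n).2 - (f n).1.2 = (y1 - y0) / 2 ^+ n.
  elim: n => [|n ih]; first by rewrite f0 expr0 divr1.
  by have [_ _ _ [_ ->] _] := fS' n; rewrite ih exprSr invfM mulrA.
have fI n : `|circulation P Q x0 x1 y0 y1| <= 4 ^+ n * `|I (f n)|.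
  elim: n => [|n ih]; first by rewrite f0 expr0 mul1r.
  have [_ _ _ _ h] := fS' n; apply: le_trans ih _.
  by rewrite exprSr -mulrA ler_pM2l ?exprn_gt0.
have [|p [q [r hd]]] := PQ (a := a) (b := b).
  by have := ha 0%N; have := hb 0%N; rewrite f0 /= => -> ->.
set w := (x1 - x0) + (y1 - y0).
have w0 : 0 <= w by rewrite /w; lra.
apply/eqP; rewrite -normr_le0; apply/ler_addgt0Pr => e e0; rewrite add0r.
(* The tolerance will be [e / (2 * (w ^+ 2 + 1))]; the [+ 1] keeps the divisor positive when the
   rectangle is a point. *)
have k0 : 0 < 2 * (w ^+ 2 + 1) by rewrite mulr_gt0 // ltr_wpDl // sqr_ge0.
have [d d0 {}hd] := hd (e / (2 * (w ^+ 2 + 1))) (divr_gt0 e0 k0).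
have [n hn] : exists n, w / 2 ^+ n < d.
  exists (Num.bound (w / d)); rewrite ltr_pdivrMr ?exprn_gt0 // mulrC -ltr_pdivrMr //.
  exact: upper_nthrootP.
have n0 : 0 < 2 ^+ n :> R by rewrite exprn_gt0.
have /and5P[xu uu ux yv /andP[vv vy]] := gf n.
have /andP[au ua] := ha n; have /andP[bv vb] := hb n.
have xd : (f n).1.1.2 - (f n).1.1.1 < d.
  by rewrite fx (le_lt_trans _ hn) // ler_pM2r ?invr_gt0 // /w; lra.
have yd : (f n).2 - (f n).1.2 < d.
  by rewrite fy (le_lt_trans _ hn) // ler_pM2r ?invr_gt0 // /w; lra.
apply: le_trans (fI n) _.
have := circulation_near PQ xu au ua ux yv bv vb vy xd yd (divr_gt0 e0 k0) hd.
rewrite fx fy -mulrDl -/w -/(I (f n)) => h.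
rewrite mulrC -ler_pdivlMr ?exprn_gt0 //; apply: le_trans h _.
(* The factor [4 ^+ n] lost by bisection is exactly the square of the scale [2 ^+ n] in the local
   estimate. *)
rewrite (_ : 4 = 2 ^+ 2); last by ring.
rewrite expr_div_n -exprM mulnC exprM mulrA ler_pM2r ?invr_gt0 ?exprn_gt0 //.
rewrite -mulrA [_ / _ * _]mulrAC mulrA ler_pdivrMr //.
by rewrite mulrCA ler_pM2l // ler_pM2l // lerDl.
Qed.
End goursat_theorem.

(** * From complex differentiability to closed real one-forms *)

Section complex_circulation.
Variable R : realType.
Local Notation C := R[i].
Local Notation normc := ComplexField.Normc.normc.
Implicit Types (w z l : C) (x y e d : R).

Lemma normc_triangle x y : normc (Complex x y) <= `|x| + `|y|.
Proof.
rewrite /normc -[leRHS]ger0_norm ?addr_ge0 // -sqrtr_sqr ler_wsqrtr //.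
rewrite sqrrD !real_normK ?num_real // addrAC lerDl.
by rewrite mulrn_wge0 // mulr_ge0.
Qed.

Lemma normc_geRe x y : `|x| <= normc (Complex x y).
Proof. by rewrite /normc -sqrtr_sqr ler_wsqrtr // lerDl sqr_ge0. Qed.

Lemma normc_geIm x y : `|y| <= normc (Complex x y).
Proof. by rewrite /normc -sqrtr_sqr ler_wsqrtr // lerDr sqr_ge0. Qed.

Lemma normc_ge0 z : 0 <= normc z.
Proof. by case: z => x y; rewrite /normc sqrtr_ge0. Qed.

(** Restates complex differentiability with real radii and real tolerances, and without a quotient,
    so that [z = w] is allowed. *)
Lemma derivable_increment (f : C -> C) w :
  derivable (f : C^o -> C^o) w 1 ->
  exists l, forall e, 0 < e -> exists2 d, 0 < d & forall z,
    normc (z - w) < d -> normc (f z - f w - l * (z - w)) <= e * normc (z - w).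
Proof.
move=> /cvg_ex[l /cvgrPdist_lt hl]; exists l => e e0.
have e0' : 0 < (Complex e 0 : C) by rewrite ltcE /= eqxx.
have := hl _ e0'.
rewrite near_withinE => -[d /= d0 hd].
(* A positive element of [R[i]] has zero imaginary part, so the complex radius [d] is a real
   number. *)
exists (complex.Re d); first by move: d0; rewrite ltcE => /andP[].
move=> z zd; have [->|zw] := eqVneq z w.
  by rewrite !subrr mulr0 subr0 ComplexField.Normc.normc0 mulr0.
have dE : d = Complex (complex.Re d) 0.
  by move: d0; rewrite ltcE; case: (d) => dr di /= /andP[/eqP ->].
have zw0 : z - w != 0 by rewrite subr_eq0.
have := hd (z - w); rewrite /ball /= sub0r normrN => /(_ _ zw0).
have -> : ((z - w)%:A + w : C) = z by rewrite /GRing.scale /= mulr1 subrK.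
have -> : `|z - w : C| = Complex (normc (z - w)) 0 by [].
rewrite {1}dE ltcE /= eqxx zd => /(_ isT).
set q := _ - _; have -> : `|q : C| = Complex (normc q) 0 by [].
rewrite ltcE /= eqxx /= => /ltW qe.
have -> : f z - f w - l * (z - w) = - (q * (z - w)).
  by rewrite /q /GRing.scale /= mulrBl mulrAC mulVf // mul1r opprB.
by rewrite normcN ComplexField.Normc.normcM ler_wpM2r ?normc_ge0.
Qed.

(** With [im_form], the coefficients of [Re (g dz) = Re g dx - Im g dy]; the circulation is then the
    real part of the contour integral of [g]. *)
Definition re_form (g : C -> C) x y := complex.Re (g (Complex x y)).
Definition im_form (g : C -> C) x y := - complex.Im (g (Complex x y)).

Lemma derivable_closed_form (g : C -> C) x0 x1 y0 y1 :
  (forall x y, x0 <= x <= x1 -> derivable (g : C^o -> C^o) (Complex x y) 1) ->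
  closed_form_on (re_form g) (im_form g) x0 x1 y0 y1.
Proof.
move=> dg rect a b /andP[xa _].
have [[p s] hl] := derivable_increment (dg a b xa).
(* Cauchy-Riemann: for the derivative [p + i s], the increment of [Re g] is [p dx - s dy] and that
   of [- Im g] is [- s dx - p dy]. Halving [d] makes the sum of the two coordinate distances less
   than [d]. *)
exists p, (- s), (- p) => e e0; have [d d0 hd] := hl e e0; exists (d / 2);
  first by rewrite divr_gt0.
move=> x y _ xad ybd.
have le_xy : normc (Complex x y - Complex a b) <= `|x - a| + `|y - b|.
  exact: normc_triangle.
have xyd : normc (Complex x y - Complex a b) < d by rewrite (le_lt_trans le_xy) //; lra.
move: (hd _ xyd); rewrite /re_form /im_form.
case: (g (Complex x y)) (g (Complex a b)) => [u v] [u0 v0] /= h.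
have {}h := le_trans h (ler_wpM2l (ltW e0) le_xy).
split; apply: le_trans h; [move: (normc_geRe)|move: normc_geIm] => norm_le.
- by apply: le_trans (norm_le _ _); rewrite le_eqVlt; apply/orP; left; apply/eqP;
    congr `|_|; ring.
- rewrite -normrN; apply: le_trans (norm_le _ _); rewrite le_eqVlt; apply/orP; left; apply/eqP;
    congr `|_|; ring.
Qed.
End complex_circulation.

(** * Concentration of the powers of a parabolic weight *)

Lemma geometric_lt (R : realType) (q A e : R) : 0 <= q < 1 -> 0 < e ->
  exists n, A * q ^+ n < e.
Proof.
move=> /andP[q0 q1] e0.
have /cvgrPdist_lt/(_ e e0) [n _ hn] : (fun n => A * q ^+ n) @ \oo --> A * 0.
  by apply: cvgMr; apply: cvg_expr; rewrite ger0_norm.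
exists n; have := hn n (leqnn n); rewrite /= mulr0 sub0r normrN.
exact: le_lt_trans (ler_norm _).
Qed.

Section concentration.
Variables (R : realType) (h : R -> R) (v L M K rho : R).
Let k y : R := 1 - ((y - v) / L) ^+ 2.
Hypotheses (L0 : 0 < L) (K0 : 0 <= K) (rho0 : 0 <= rho) (rho34 : rho < 3 / 4).
Hypothesis hM : forall y, v - L <= y <= v + L -> `|h y| <= M.
Hypothesis hc : forall e, 0 < e -> exists2 d, 0 < d &
  forall y, `|y - v| < d -> `|h y - h v| < e.
Hypothesis hi : forall n, integrable_on (v - L) (v + L) (fun y => h y * k y ^+ n).
Hypothesis hK : forall n,
  segint (v - L) (v + L) (fun y => h y * k y ^+ n) <= K * rho ^+ n.

(* The weights [k y ^+ n] concentrate at [y = v], where [k] has its maximum 1. *)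
Lemma concentration_le0 : h v <= 0.
Proof.
rewrite leNgt; apply/negP => hv0.
have hv2 : 0 < h v / 2 by rewrite divr_gt0.
have [d1 d10 hd1] := hc hv2.
pose d := Num.min d1 L.
have d0 : 0 < d by rewrite lt_min d10.
have dL : d <= L by rewrite ge_min lexx orbT.
have hd y : `|y - v| < d -> h v / 2 <= h y.
  rewrite lt_min => /andP[/hd1 + _]; rewrite ltr_norml => /andP[]; lra.
(* [kap] and [lam] below are the values of [k] at distance [d / 2] and [d] from [v]. Since [d <= L],
   [eta <= 1 / 2], hence [kap >= 3 / 4 > rho] and [lam >= 0]. *)
pose eta := d / (2 * L).
have eta0 : 0 < eta by rewrite divr_gt0 // mulr_gt0.
have eta1 : eta <= 1 / 2 by rewrite ler_pdivrMr ?mulr_gt0 //; lra.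
pose kap := 1 - eta ^+ 2; pose lam := 1 - 4 * eta ^+ 2.
have kap34 : 3 / 4 <= kap by rewrite /kap; nra.
have lam0 : 0 <= lam by rewrite /lam; nra.
have lamkap : lam < kap by rewrite /lam /kap; nra.
have k0 y : v - L <= y <= v + L -> 0 <= k y.
  move=> yL; have : `|(y - v) / L| <= 1.
    by rewrite normrM normfV (gtr0_norm L0) ler_pdivrMr // mul1r ler_norml; lra.
  by rewrite -ler_sqr ?nnegrE // real_normK ?num_real // expr1n subr_ge0.
have klam y : d <= `|y - v| -> k y <= lam.
  move=> dy; rewrite /k /lam lerD2l lerN2.
  rewrite (_ : 4 * eta ^+ 2 = (d / L) ^+ 2); last by rewrite /eta; field; rewrite gt_eqF.
  have dL0 : 0 <= d / L by rewrite divr_ge0 // ltW.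
  rewrite -[leRHS]real_normK ?num_real // ler_sqr ?nnegrE //.
  by rewrite normrM normfV (gtr0_norm L0) ler_pM2r ?invr_gt0.
have kkap y : `|y - v| <= d / 2 -> kap <= k y.
  move=> dy; rewrite /k /kap lerD2l lerN2.
  rewrite -[leLHS]real_normK ?num_real // ler_sqr ?nnegrE ?(ltW eta0) //.
  rewrite normrM normfV (gtr0_norm L0) ler_pdivrMr //.
  by rewrite (le_trans dy) // /eta invfM mulrA mulfVK ?gt_eqF.
have M0 : 0 <= M by apply: le_trans (hM (y := v) _) => //; lra.
(* Within distance [d] of [v] the integrand is nonnegative; farther away [h] may be negative, but
   the weight is at most [lam ^+ n]. *)
have outer n y : v - L <= y <= v + L -> - (M * lam ^+ n) <= h y * k y ^+ n.
  move=> yL; case: (ltP `|y - v| d) => [/hd hy|/klam dy].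
    have : 0 <= h y * k y ^+ n.
      by rewrite mulr_ge0 ?exprn_ge0 ?k0 // (le_trans _ hy) // ltW // divr_gt0.
    by apply: le_trans; rewrite oppr_le0 mulr_ge0 ?exprn_ge0.
  have : `|h y * k y ^+ n| <= M * lam ^+ n.
    by rewrite normrM normrX (ger0_norm (k0 _ yL)) ler_pM ?exprn_ge0 ?k0 ?hM //
      lerXn2r // nnegrE ?k0.
  by rewrite ler_norml => /andP[].
have inner n y : v - d / 2 <= y <= v + d / 2 -> h v / 2 * kap ^+ n <= h y * k y ^+ n.
  move=> yd; have yd2 : `|y - v| <= d / 2 by rewrite ler_norml; lra.
  apply: ler_pM; rewrite ?exprn_ge0 //; [lra|lra| | ].
    by apply: hd; rewrite (le_lt_trans yd2) //; lra.
  by rewrite lerXn2r ?nnegrE ?kkap //; [lra|apply: k0; lra].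
(* The central segment of length [d] contributes the left side, and the two outer ones lose at most
   [2 * L * M * lam ^+ n]. As [rho] and [lam] are both below [kap], this fails for some [n]. *)
have main n : h v / 2 * d * kap ^+ n <= (K + 2 * L * M) * Num.max rho lam ^+ n.
  have := hK n.
  have c1 : v - L <= v - d / 2 by lra.
  have c2 : v - d / 2 <= v + L by lra.
  have c3 : v - d / 2 <= v + d / 2 by lra.
  have c4 : v + d / 2 <= v + L by lra.
  rewrite (segint_split c1 c2 (hi n)).
  rewrite (segint_split c3 c4 (integrable_onS c1 (lexx _) (hi n))).
  have s1 : - (M * lam ^+ n) * (v - d / 2 - (v - L)) <=
      segint (v - L) (v - d / 2) (fun y => h y * k y ^+ n).
    apply: segint_ge => [||y yy]; [lra|by apply: integrable_onS (hi n); lra|].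
    by apply: outer; lra.
  have s2 : h v / 2 * kap ^+ n * (v + d / 2 - (v - d / 2)) <=
      segint (v - d / 2) (v + d / 2) (fun y => h y * k y ^+ n).
    apply: segint_ge => [||y yy]; [lra|by apply: integrable_onS (hi n); lra|].
    by apply: inner; lra.
  have s3 : - (M * lam ^+ n) * (v + L - (v + d / 2)) <=
      segint (v + d / 2) (v + L) (fun y => h y * k y ^+ n).
    apply: segint_ge => [||y yy]; [lra|by apply: integrable_onS (hi n); lra|].
    by apply: outer; lra.
  move=> sK.
  have lm : lam ^+ n <= Num.max rho lam ^+ n.
    by rewrite lerXn2r ?nnegrE // ?le_max ?lam0 ?lexx ?orbT.
  have rm : rho ^+ n <= Num.max rho lam ^+ n.
    by rewrite lerXn2r ?nnegrE // ?le_max ?rho0 ?lexx.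
  have l0 : 0 <= lam ^+ n by rewrite exprn_ge0.
  have m1 := ler_wpM2l K0 rm.
  have m2 := ler_wpM2l (mulr_ge0 (ltW L0) M0) lm.
  have m3 : 0 <= d * (M * lam ^+ n) by rewrite !mulr_ge0 // ltW.
  nra.
have kap0 : 0 < kap by lra.
have [||n] := @geometric_lt R (Num.max rho lam / kap) (K + 2 * L * M) (h v / 2 * d).
- apply/andP; split; first by rewrite divr_ge0 ?(ltW kap0) // le_max rho0.
  by rewrite ltr_pdivrMr // mul1r gt_max lamkap (lt_le_trans rho34 kap34).
- by rewrite !mulr_gt0.
rewrite expr_div_n mulrA ltr_pdivrMr ?exprn_gt0 // => /lt_le_trans/(_ (main n)).
by rewrite ltxx.
Qed.
End concentration.

(** * The identity principle on the half-plane *)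

Section vanishing.
Variable R : realType.
Local Notation C := R[i].
Local Notation normc := ComplexField.Normc.normc.

Lemma derivable_continuous (f : C -> C) (w : C) : derivable (f : C^o -> C^o) w 1 ->
  forall e : R, 0 < e -> exists2 d : R, 0 < d & forall z,
    normc (z - w) < d -> normc (f z - f w) < e.
Proof.
move=> /derivable_increment[l /(_ 1 ltr01)[d d0 hd]] e e0.
have l1 : 0 < 1 + normc l by rewrite ltr_wpDr ?normc_ge0.
exists (Num.min d (e / (1 + normc l))); first by rewrite lt_min d0 divr_gt0.
move=> z; rewrite lt_min ltr_pdivlMr // mulrC => /andP[/hd zd].
apply: le_lt_trans; rewrite mulrDl -ComplexField.Normc.normcM.
rewrite -{1}(subrK (l * (z - w)) (f z - f w)).
by apply: le_trans (le_normcD _ _) _; rewrite lerD2r.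
Qed.

Lemma dist_normc (z w : C) : `|normc z - normc w| <= normc (z - w).
Proof.
have e : normc (w - z) = normc (z - w) by rewrite -normcN opprB.
have := le_normcD (z - w) w; have := le_normcD (w - z) z.
by rewrite !subrK e ler_norml; lra.
Qed.

Lemma segment_bounded (h : R -> R) (a b : R) :
  (forall t, a <= t <= b -> forall e, 0 < e -> exists2 d, 0 < d &
     forall s, `|s - t| < d -> `|h s - h t| < e) ->
  exists M, forall t, a <= t <= b -> `|h t| <= M.
Proof.
move=> ch.
have /compact_bounded[M [_ hM]] : compact (h @` `[a, b]).
  apply: continuous_compact; last exact: segment_compact.
  apply/continuous_in_subspaceT => t; rewrite inE /= in_itv /= => tab.
  apply/cvgrPdist_lt => e e0; have [d d0 hd] := ch t tab e e0.
  near=> s; rewrite distrC; apply: hd; rewrite distrC; near: s.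
  exact: cvgr_dist_lt.
exists (M + 1) => t tab; apply: (hM (M + 1)); first by rewrite ltrDl.
by exists t => //=; rewrite in_itv.
Unshelve. all: end_near. Qed.

Variables (f : C -> C) (B : R).
Hypothesis df : forall w : C, 0 < complex.Re w -> derivable (f : C^o -> C^o) w 1.
Hypothesis f0 : forall w : C, B < complex.Re w -> f w = 0.

Let normc_continuous (w : C) : 0 < complex.Re w -> forall e, 0 < e ->
  exists2 d : R, 0 < d & forall z, normc (z - w) < d -> `|normc (f z) - normc (f w)| < e.
Proof.
move=> /df/derivable_continuous h e /h[d d0 hd]; exists d => // z /hd.
exact: le_lt_trans (dist_normc _ _).
Qed.

Let bounded_horizontal u1 u2 y : 0 < u1 ->
  exists M, forall x, u1 <= x <= u2 -> normc (f (Complex x y)) <= M.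
Proof.
move=> u0; have [t tu e e0|M hM] := @segment_bounded (fun x => normc (f (Complex x y))) u1 u2.
  have [|d d0 hd] := normc_continuous (w := Complex t y) _ e0; first by rewrite /=; lra.
  exists d => // s sd; apply: hd; apply: le_lt_trans (normc_triangle _ _) _.
  by rewrite subrr normr0 addr0.
by exists M => x /hM; apply: le_trans; exact: ler_norm.
Qed.

Let bounded_vertical v1 v2 x : 0 < x ->
  exists M, forall y, v1 <= y <= v2 -> normc (f (Complex x y)) <= M.
Proof.
move=> x0; have [t tu e e0|M hM] := @segment_bounded (fun y => normc (f (Complex x y))) v1 v2.
  have [|d d0 hd] := normc_continuous (w := Complex x t) _ e0; first by [].
  exists d => // s sd; apply: hd; apply: le_lt_trans (normc_triangle _ _) _.
  by rewrite subrr normr0 add0r.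
by exists M => y /hM; apply: le_trans; exact: ler_norm.
Qed.

Let kernel (w : C) (L : R) : C -> C := fun z => 1 + ((z - w) * Complex L^-1 0) ^+ 2.

Let derivable_weighted w L n z : 0 < complex.Re z ->
  derivable ((fun z => f z * kernel w L z ^+ n) : C^o -> C^o) z 1.
Proof.
move=> z0.
have dk : derivable (kernel w L : C^o -> C^o) z 1.
  have -> : (kernel w L : C^o -> C^o) =
      cst (1 : C^o) + ((id - cst w) * cst (Complex L^-1 0 : C^o)) ^+ 2.
    by apply/funext => t; rewrite /kernel !fctE.
  apply: derivableD; first exact: derivable_cst.
  apply: derivableX; apply: derivableM; last exact: derivable_cst.
  apply: derivableB; [exact: derivable_id|exact: derivable_cst].
have -> : ((fun z => f z * kernel w L z ^+ n) : C^o -> C^o) =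
    (f : C^o -> C^o) * (kernel w L : C^o -> C^o) ^+ n.
  by apply/funext => t; rewrite !fctE.
by apply: derivableM; [exact: df|exact: derivableX].
Qed.

Let kernel_vertical u v L y :
  kernel (Complex u v) L (Complex u y) = Complex (1 - ((y - v) / L) ^+ 2) 0.
Proof.
rewrite /kernel expr2; apply/eqP; rewrite eq_complex /=.
by apply/andP; split; apply/eqP; ring.
Qed.

(** With [q = (x - u) / L] in [[0, 1/4]] and [s = (t - v) / L = 1] or [-1], the kernel is
    [1 + (q + i s)^2 = q^2 + 2 i q s], of modulus at most [q^2 + 2 q <= 9/16]. This is below the
    threshold [3/4] of [concentration_le0]. *)
Let kernel_horizontal u v L x t : 0 < L -> `|t - v| = L ->
  u <= x <= u + L / 4 -> normc (kernel (Complex u v) L (Complex x t)) <= 9 / 16.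
Proof.
move=> L0 tL xu.
have [s sE s1] : exists2 s, (t - v) / L = s & `|s| = 1.
  exists ((t - v) / L) => //.
  by rewrite normrM normfV (gtr0_norm L0) tL divff // gt_eqF.
pose q := (x - u) / L.
have q0 : 0 <= q by rewrite divr_ge0 ?(ltW L0) //; lra.
have q4 : q <= 1 / 4 by rewrite ler_pdivrMr //; lra.
have s2 : s * s = 1 by rewrite -expr2 -real_normK ?num_real // s1 expr1n.
have -> : kernel (Complex u v) L (Complex x t) = Complex (q ^+ 2) (2 * q * s).
  rewrite /kernel expr2; apply/eqP; rewrite eq_complex /=.
  rewrite !mulr0 !subr0 !add0r -/q sE s2; apply/andP; split; apply/eqP; ring.
apply: le_trans (normc_triangle _ _) _; move: (q) q0 q4 => r q0 q4.
rewrite !normrM s1 (ger0_norm q0) !ger0_norm ?sqr_ge0 // mulr1; nra.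
Qed.

(** A one-sided bound on one real component; applied to multiples of [f], it controls every
    component. *)
Lemma im_form_le0 u v : 0 < u -> im_form f u v <= 0.
Proof.
(* The right side [x1] lies beyond [B], where [f] vanishes, and [L] is chosen so that
   [x1 = u + L / 4], the limit in [kernel_horizontal]. *)
move=> u0; pose x1 := Num.max B u + 1; pose L := 4 * (x1 - u).
have ux1 : u < x1.
  by have : u <= Num.max B u by [rewrite le_max lexx orbT]; rewrite /x1; lra.
have Bx1 : B < x1.
  by have : B <= Num.max B u by [rewrite le_max lexx]; rewrite /x1; lra.
have L0 : 0 < L by rewrite /L; lra.
pose G n := fun z => f z * kernel (Complex u v) L z ^+ n.
have [M1 hM1] := bounded_horizontal x1 (v - L) u0.
have [M2 hM2] := bounded_horizontal x1 (v + L) u0.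
have [M hM] := bounded_vertical (v - L) (v + L) u0.
have hP n t (N : R) : `|t - v| = L -> (forall x, u <= x <= x1 -> normc (f (Complex x t)) <= N) ->
    forall x, u <= x <= x1 -> `|re_form (G n) x t| <= N * (9 / 16) ^+ n.
  move=> tL hN x xu.
  have : `|re_form (G n) x t| <= normc (G n (Complex x t)).
    by rewrite /re_form; case: (G n _) => p q; exact: normc_geRe.
  move=> /le_trans; apply; rewrite /G ComplexField.Normc.normcM.
  have -> k : normc (k ^+ n) = normc k ^+ n.
    elim: n => [|n ih]; first by rewrite !expr0 ComplexField.Normc.normc1.
    by rewrite !exprS ComplexField.Normc.normcM ih.
  apply: ler_pM; rewrite ?exprn_ge0 ?normc_ge0 ?hN // lerXn2r ?nnegrE ?normc_ge0 //.
  by apply: kernel_horizontal => //; rewrite /L; lra.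
(* On the left side the power of the kernel is real and factors out of the imaginary part. *)
have QE n : im_form (G n) u = fun y => im_form f u y * (1 - ((y - v) / L) ^+ 2) ^+ n.
  apply/funext => y; rewrite /im_form /G kernel_vertical.
  have -> k : (Complex k 0 : C) ^+ n = Complex (k ^+ n) 0.
    elim: n => [|n ih]; first by rewrite !expr0.
    by rewrite !exprS ih; apply/eqP; rewrite eq_complex /= !mul0r !mulr0 subr0 addr0 !eqxx.
  by case: (f _) => p q /=; ring.
have Gcl n : closed_form_on (re_form (G n)) (im_form (G n)) u x1 (v - L) (v + L).
  by apply: derivable_closed_form => x y xu; apply: derivable_weighted => /=; lra.
have yL : v - L <= v + L by lra.
have uxx : u <= u <= x1 by lra.
have iQ n := integrable_vertical (Gcl n) (lexx (v - L)) (lexx (v + L)) uxx.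
have uux : u <= x1 by lra.
have M10 : 0 <= M1 by exact: le_trans (normc_ge0 _) (hM1 u uxx).
have M20 : 0 <= M2 by exact: le_trans (normc_ge0 _) (hM2 u uxx).
have K0 : 0 <= (M1 + M2) * (x1 - u) by apply: mulr_ge0; lra.
have im_le (w : C) : `|complex.Im w| <= normc w by case: w => p q; move: (normc_geIm p q).
apply: (@concentration_le0 R (im_form f u) v L M _ (9 / 16) L0 K0).
- by lra.
- by lra.
- by move=> y yv; rewrite /im_form normrN (le_trans (im_le _)) // hM.
- move=> e e0; have [|d d0 hd] := derivable_continuous (df (w := Complex u v) _) e0.
    by [].
  exists d => // y yd; rewrite /im_form.
  have := hd (Complex u y); case: (f (Complex u y)) (f (Complex u v)) => p q [p' q'] /= h.
  apply: le_lt_trans (h _).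
    by rewrite opprK addrC distrC; move: (normc_geIm (p - p') (q - q')).
  by apply: le_lt_trans (normc_triangle _ _) _; rewrite subrr normr0 add0r.
- by move=> n; rewrite -QE.
- move=> n; rewrite -QE.
  (* The right side contributes 0, so the left integral equals the bottom integral minus the top
     one, and both decay like [(9 / 16) ^+ n]. *)
  have := goursat_rectangle (Gcl n) uux yL.
  rewrite (circulationE (Gcl n)) //.
  have -> : im_form (G n) x1 = fun=> 0.
    by apply/funext => y; rewrite /im_form /G f0 // mul0r oppr0.
  rewrite segint_cst // mul0r.
  have p1 : segint u x1 (re_form (G n) ^~ (v - L)) <= M1 * (9 / 16) ^+ n * (x1 - u).
    apply: segint_le => //; first by apply: (integrable_horizontal (Gcl n)) => //; lra.
    move=> x xu; apply: le_trans (ler_norm _) (hP _ _ _ _ hM1 _ xu).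
    by rewrite addrC addKr normrN gtr0_norm.
  have p2 : - (M2 * (9 / 16) ^+ n) * (x1 - u) <= segint u x1 (re_form (G n) ^~ (v + L)).
    apply: segint_ge => //; first by apply: (integrable_horizontal (Gcl n)) => //; lra.
    move=> x xu; have : `|re_form (G n) x (v + L)| <= M2 * (9 / 16) ^+ n.
      by apply: hP => //; rewrite addrC addKr gtr0_norm.
    by rewrite ler_norml => /andP[].
  move: (segint _ _ (im_form _ _)) (segint _ _ _) (segint _ _ _) p1 p2 => SQ S1 S2.
  move: ((9 / 16) ^+ n) => r p1 p2 /eqP.
  rewrite sub0r subr_eq0 => /eqP <-.
  have -> : (M1 + M2) * (x1 - u) * r = M1 * r * (x1 - u) - - (M2 * r) * (x1 - u).
    by move: (x1 - u) => t; ring.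
  exact: lerB p1 p2.
Qed.

End vanishing.

(** Applying [im_form_le0] to [c f] for [c] among [1, -1, i, -i] bounds the real and imaginary parts
    of [f] by 0 from both sides. *)
Lemma vanishing_half_plane (R : realType) (f : R[i] -> R[i]) (B : R) :
  holomorphic_on_rhp f -> (forall w, B < complex.Re w -> f w = 0) ->
  forall w, 0 < complex.Re w -> f w = 0.
Proof.
move=> hf f0 [u v] /= u0.
have sgn (c : R[i]) : im_form (fun z => c * f z) u v <= 0.
  apply: (@im_form_le0 R (fun z => c * f z) B) u0 => w w0.
    have dcf : derivable ((cst c : R[i]^o -> R[i]^o) * (f : R[i]^o -> R[i]^o)) w 1.
      apply: derivableM; [exact: derivable_cst|exact: hf].
    exact: dcf.
  by rewrite f0 // mulr0.
have := sgn (Complex 1 0); have := sgn (Complex (-1) 0).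
have := sgn (Complex 0 1); have := sgn (Complex 0 (-1)).
rewrite /im_form; case: (f _) => p q /= h1 h2 h3 h4.
by apply/eqP; rewrite eq_complex /=; apply/andP; split; apply/eqP; lra.
Qed.

(** * Mean squares on vertical lines *)

Section vertical_integrals.
Variable R : realType.
Local Notation C := R[i].
Local Notation normc := ComplexField.Normc.normc.
Local Notation mu := (@lebesgue_measure R).
Implicit Types (f g : C -> C) (x B : R).

Definition normc_sqr f x y : R := normc (f (Complex x y)) ^+ 2.

Definition line_integral f x : \bar R := (\int[mu]_(y in [set: R]) (normc_sqr f x y)%:E)%E.

Definition tail_sqnorm f B : \bar R :=
  ereal_sup [set ((pi^-1)%:E * line_integral f x)%E | x in [set x : R | B < x]].

Lemma h2_sqnorm_tail f : h2_sqnorm f = tail_sqnorm f 0.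
Proof. by []. Qed.

Lemma normc_sqr_continuous f x : holomorphic_on_rhp f -> 0 < x ->
  continuous (normc_sqr f x).
Proof.
move=> hf x0 y; suff cn : {for y, continuous (fun y => normc (f (Complex x y)))}.
  exact: (continuousM cn cn).
apply/cvgrPdist_lt => e e0.
have [d d0 hd] := derivable_continuous (hf (Complex x y) x0) e0.
near=> t; rewrite distrC; apply: le_lt_trans (dist_normc _ _) _; apply: hd.
apply: le_lt_trans (normc_triangle _ _) _.
rewrite subrr normr0 add0r distrC; near: t; exact: cvgr_dist_lt.
Unshelve. all: end_near. Qed.

Lemma line_integral_ge0 f x : (0 <= line_integral f x)%E.
Proof. by apply: integral_ge0 => y _; rewrite lee_fin sqr_ge0. Qed.

Lemma tail_sqnorm_ge0 f B : (0 <= tail_sqnorm f B)%E.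
Proof.
apply: le_trans (_ : _ <= (pi^-1)%:E * line_integral f (B + 1))%E _.
  by rewrite mule_ge0 ?line_integral_ge0 // lee_fin invr_ge0 pi_ge0.
by apply: ereal_sup_ubound; exists (B + 1) => //=; rewrite ltrDl.
Qed.

Lemma integral_affine (G : R -> R) (a c : R) : 0 < a -> continuous G ->
  (forall y, 0 <= G y) ->
  (\int[mu]_y (G (a * y + c))%:E = (a^-1)%:E * \int[mu]_y (G y)%:E)%E.
Proof.
move=> a0 cG G0; pose F y := a * y + c.
have dF y : is_derive y (1 : R) F a.
  have -> : F = (a \*: (@idfun R : R -> R^o) : R -> R^o) + cst c by apply/funext => z.
  by apply: is_derive_eq; rewrite /GRing.scale /= mulr1 addr0.
have F'E : F^`()%classic = fun=> a.
  by apply/funext => y; rewrite derive1E derive_val.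
have cF : continuous (fun y => G (F y)).
  move=> y; apply: continuous_comp; last exact: cG.
  by apply: cvgD; [apply: cvgM; [exact: cvg_cst|exact: cvg_id]|exact: cvg_cst].
(* Substituting [F] on the right brings in the factor [F' = a], which cancels [a^-1]. *)
rewrite [in RHS](@increasing_ge0_integration_by_substitutionT R F G) //.
- rewrite F'E; under [in RHS]eq_integral do rewrite /= mulrC EFinM.
  rewrite ge0_integralZl_EFin ?ltW //.
  + by rewrite muleA -EFinM mulVf ?gt_eqF // mul1e.
  + by move=> y _; rewrite lee_fin; exact: G0.
  + by apply/measurable_EFinP; exact: continuous_measurable_fun.
- by move=> y z yz; rewrite /F ltrD2r ltr_pM2l.
- by rewrite F'E => y; exact: cvg_cst.
- by rewrite F'E; exact: is_cvg_cst.
- by rewrite F'E; exact: is_cvg_cst.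
- apply/cvgrNyPle => A; near=> y.
  rewrite /F -lerBrDr mulrC -ler_pdivlMr //; near: y.
- apply/cvgryPge => A; near=> y.
  rewrite /F -lerBlDr mulrC -ler_pdivrMr //; near: y.
Unshelve. all: end_near. Qed.

End vertical_integrals.

(** * Action of the composition operator on tails *)

Section affine_composition.
Variables (R : realType) (a : R) (b : R[i]).
Local Notation C := R[i].
Local Notation normc := ComplexField.Normc.normc.
Local Notation mu := (@lebesgue_measure R).
Implicit Types (f g : C -> C) (x B : R).
Local Notation p := (complex.Re b).
Local Notation T := (comp_op (fun w : C => Complex a 0 * w + b)).

Lemma tail_sqnorm_anti f B B' : B <= B' -> (tail_sqnorm f B' <= tail_sqnorm f B)%E.
Proof.
move=> BB'; apply: ereal_sup_le => _ [x /= xB <-].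
by exists x => //=; exact: le_lt_trans xB.
Qed.

Hypotheses (a0 : 0 < a) (p0 : 0 <= p).

Lemma affine_rhp (w : C) : rhp w -> rhp (Complex a 0 * w + b).
Proof.
case: b p0 w => b1 b2 /= b0 [x y]; rewrite /rhp /= mul0r subr0 => x0.
by rewrite ltr_wpDr // mulr_gt0.
Qed.

Lemma holomorphic_comp f : holomorphic_on_rhp f -> holomorphic_on_rhp (T f).
Proof.
move=> hf w w0; apply/derivable1_diffP.
have dphi : differentiable ((fun w : C => Complex a 0 * w + b) : C^o -> C^o) (w : C^o).
  apply/derivable1_diffP.
  have h : derivable ((cst (Complex a 0 : C^o)) * (id : C^o -> C^o) + cst (b : C^o)) w 1.
    apply: derivableD; last exact: derivable_cst.
    by apply: derivableM; [exact: derivable_cst|exact: derivable_id].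
  exact: h.
apply: (differentiable_comp dphi).
by apply/derivable1_diffP; apply: hf; exact: affine_rhp.
Qed.

(** The affine map sends the line [Re = x] to [Re = a * x + p] and acts on ordinates by
    [y |-> a * y + Im b], whence the Jacobian factor [a^-1]. *)
Lemma line_integral_comp f x : holomorphic_on_rhp f -> 0 < a * x + p ->
  line_integral (T f) x = ((a^-1)%:E * line_integral f (a * x + p))%E.
Proof.
move=> hf x0; rewrite /line_integral.
rewrite -(@integral_affine R (normc_sqr f (a * x + p)) a (complex.Im b)) //.
- apply: eq_integral => y _; rewrite /normc_sqr /comp_op /=; congr ((normc (f _)) ^+ 2)%:E.
  by case: (b) => b1 b2; apply/eqP; rewrite eq_complex /=; apply/andP; split; apply/eqP; ring.
- exact: normc_sqr_continuous.
- by move=> y; rewrite sqr_ge0.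
Qed.

(** The abscissas [x > B] correspond bijectively to those beyond [a * B + p]. The sign condition
    keeps the image lines inside the half-plane, where [f] is continuous. *)
Lemma tail_sqnorm_comp f B : holomorphic_on_rhp f -> 0 <= a * B + p ->
  tail_sqnorm (T f) B = ((a^-1)%:E * tail_sqnorm f (a * B + p))%E.
Proof.
move=> hf B0.
have lineE x : B < x -> ((pi^-1)%:E * line_integral (T f) x =
    (a^-1)%:E * ((pi^-1)%:E * line_integral f (a * x + p)))%E.
  move=> Bx; rewrite line_integral_comp // 1?muleCA //.
  by rewrite (le_lt_trans B0) // ltrD2r ltr_pM2l.
apply/eqP; rewrite eq_le; apply/andP; split.
  apply: ge_ereal_sup => _ [x /= Bx <-]; rewrite lineE //.
  rewrite lee_wpmul2l ?lee_fin ?invr_ge0 ?(ltW a0) //; apply: ereal_sup_ubound.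
  by exists (a * x + p) => //=; rewrite ltrD2r ltr_pM2l.
(* For the converse inequality, the line at [x] is the image of the line at [(x - p) / a]. *)
rewrite lee_pdivrMl //; apply: ge_ereal_sup => _ [x /= Bx <-].
have Bx' : B < (x - p) / a by rewrite ltr_pdivlMr // ltrBrDr mulrC.
apply: (@le_trans _ _ (a%:E * ((pi^-1)%:E * line_integral (T f) ((x - p) / a)))%E).
  rewrite lineE // muleA -EFinM divff ?gt_eqF // mul1e.
  by rewrite [a * _]mulrC divfK ?gt_eqF // subrK.
rewrite lee_wpmul2l ?lee_fin ?(ltW a0) //; apply: ereal_sup_ubound.
by exists ((x - p) / a).
Qed.

(** At [B = 0] the squared norm of [T f] is [a^-1] times the tail of [f] at [p], which the squared
    norm of [f] dominates. *)
Lemma in_H2_comp f : in_H2 f -> in_H2 (T f).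
Proof.
move=> [hf ff]; split; first exact: holomorphic_comp.
rewrite h2_sqnorm_tail tail_sqnorm_comp ?mulr0 ?add0r //.
have fin : (tail_sqnorm f p < +oo)%E by apply: le_lt_trans (tail_sqnorm_anti f p0) ff.
have : tail_sqnorm f p \is a fin_num by rewrite ge0_fin_numE // tail_sqnorm_ge0.
by move=> /fineK <-; rewrite -EFinM ltry.
Qed.

Lemma in_H2_iter n f : in_H2 f -> in_H2 (iter n T f).
Proof. by move=> fH; elim: n => //= n; exact: in_H2_comp. Qed.

Lemma iter_compB n f g : iter n T f - iter n T g = iter n T (f - g).
Proof. by elim: n => //= n <-. Qed.

End affine_composition.

(** * Differences and vanishing in the Hardy space *)

Section H2_functions.
Variable R : realType.
Local Notation C := R[i].
Local Notation normc := ComplexField.Normc.normc.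
Local Notation mu := (@lebesgue_measure R).
Implicit Types (f g : C -> C) (x B : R).

Lemma normc_sqr_measurable f x : holomorphic_on_rhp f -> 0 < x ->
  measurable_fun [set: R] (EFin \o normc_sqr f x).
Proof.
move=> hf x0; apply/measurable_EFinP; apply: continuous_measurable_fun.
exact: normc_sqr_continuous.
Qed.

(** This replaces Minkowski's inequality: it suffices for the finiteness of the norm of a
    difference. *)
Lemma normc_sqrB f g x y :
  normc_sqr (f - g) x y <= 2 * normc_sqr f x y + 2 * normc_sqr g x y.
Proof.
rewrite /normc_sqr (_ : (f - g) _ = f (Complex x y) - g (Complex x y)) //.
move: (f _) (g _) => u v; have := le_normcD u (- v); rewrite normcN.
have := normc_ge0 (u - v).
move: (normc (u - v)) (normc u) (normc v) => r s t r0 h.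
have : r ^+ 2 <= (s + t) ^+ 2 by rewrite ler_sqr ?nnegrE ?(le_trans r0 h).
by have := sqr_ge0 (s - t); rewrite sqrrB sqrrD; lra.
Qed.

Lemma in_H2B f g : in_H2 f -> in_H2 g -> in_H2 (f - g).
Proof.
move=> [hf ff] [hg gg].
have hfg : holomorphic_on_rhp (f - g).
  move=> w w0.
  have d : derivable ((f : C^o -> C^o) - (g : C^o -> C^o)) w 1.
    by apply: derivableB; [exact: hf|exact: hg].
  exact: d.
split => //.
have finite h : (h2_sqnorm h < +oo)%E -> exists2 M : R, 0 <= M & forall x, 0 < x ->
    (line_integral h x <= M%:E)%E.
  move=> hh; have h0 := tail_sqnorm_ge0 h 0; rewrite -h2_sqnorm_tail in h0.
  have fh : h2_sqnorm h \is a fin_num by rewrite ge0_fin_numE.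
  exists (pi * fine (h2_sqnorm h)); first by rewrite mulr_ge0 ?pi_ge0 ?fine_ge0.
  move=> x x0; rewrite EFinM fineK // -lee_pdivrMl ?pi_gt0 //.
  by apply: ereal_sup_ubound; exists x.
have [M M0 hM] := finite f ff; have [N N0 hN] := finite g gg.
rewrite h2_sqnorm_tail.
apply: (@le_lt_trans _ _ (pi^-1 * (2 * M + 2 * N))%:E); last exact: ltry.
apply: ge_ereal_sup => _ [x /= x0 <-].
rewrite EFinM lee_wpmul2l ?lee_fin ?invr_ge0 ?pi_ge0 //.
have mf := normc_sqr_measurable hf x0; have mg := normc_sqr_measurable hg x0.
have m2 h : measurable_fun [set: R] (EFin \o normc_sqr h x) ->
    measurable_fun [set: R] (fun y => 2%:E * (normc_sqr h x y)%:E)%E.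
  by move=> mh; exact: measurable_funeM.
have E h : measurable_fun [set: R] (EFin \o normc_sqr h x) ->
    (\int[mu]_y (2%:E * (normc_sqr h x y)%:E) = 2%:E * line_integral h x)%E.
  by move=> mh; rewrite ge0_integralZl_EFin // => y _; rewrite lee_fin sqr_ge0.
apply: (@le_trans _ _ (\int[mu]_y (2%:E * (normc_sqr f x y)%:E + 2%:E * (normc_sqr g x y)%:E))%E).
  apply: ge0_le_integral => //.
  - by move=> y _; rewrite lee_fin sqr_ge0.
  - exact: normc_sqr_measurable.
  - by apply: emeasurable_funD; exact: m2.
  - by move=> y _; rewrite -!EFinM -EFinD lee_fin normc_sqrB.
rewrite ge0_integralD //; try exact: m2.
- rewrite !E // [leRHS]EFinD 2!EFinM; apply: leeD; rewrite lee_wpmul2l ?lee_fin //;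
    [exact: hM|exact: hN].
- by move=> y _; rewrite -EFinM lee_fin mulr_ge0 ?sqr_ge0.
- by move=> y _; rewrite -EFinM lee_fin mulr_ge0 ?sqr_ge0.
Qed.

(** If [G v > 0], then [G >= G v / 2] on a segment of length [d] around [v], and the integral is at
    least [G v / 2 * d > 0]. *)
Lemma continuous_integral_eq0 (G : R -> R) : continuous G -> (forall y, 0 <= G y) ->
  (\int[mu]_y (G y)%:E = 0)%E -> forall y, G y = 0.
Proof.
move=> cG G0 IG v; apply/eqP; rewrite eq_le G0 andbT leNgt; apply/negP => Gv.
have Gv2 : 0 < G v / 2 by rewrite divr_gt0.
have /cvgrPdist_lt/(_ _ Gv2) [d /= d0 hd] := cG v.
have hG y : v - d / 2 <= y <= v + d / 2 -> G v / 2 <= G y.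
  move=> yd; have : `|G v - G y| < G v / 2.
    by apply: hd; rewrite /ball /= ltr_norml; lra.
  by rewrite ltr_norml; lra.
have : ((G v / 2 * d)%:E <= \int[mu]_y (G y)%:E)%E.
  apply: (@le_trans _ _ (\int[mu]_(y in `[(v - d / 2)%R, (v + d / 2)%R]) (G y)%:E)%E); last first.
    apply: ge0_subset_integral => //; last by move=> y _; rewrite lee_fin.
    by apply/measurable_EFinP; exact: continuous_measurable_fun.
  apply: (@le_trans _ _ (\int[mu]_(y in `[(v - d / 2)%R, (v + d / 2)%R]) (G v / 2)%R%:E)%E).
    rewrite integral_cst //= lebesgue_measure_itv /= lte_fin ifT; last by lra.
    by rewrite -EFinB -EFinM lee_fin (_ : v + d / 2 - (v - d / 2) = d) //; lra.
  apply: ge0_le_integral => //.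
  - by move=> y _; rewrite lee_fin ltW.
  - by apply/measurable_EFinP; apply: measurable_funS (continuous_measurable_fun cG).
by rewrite IG lee_fin leNgt mulr_gt0.
Qed.

(** Every line beyond [B] has mean square 0, so by continuity [f] vanishes at each of its points;
    the identity principle does the rest. *)
Lemma tail_sqnorm_eq0 f B : in_H2 f -> 0 <= B -> tail_sqnorm f B = 0%E ->
  forall w, 0 < complex.Re w -> f w = 0.
Proof.
move=> [hf _] B0 tf; apply: (@vanishing_half_plane R f B) => // -[x y] /= Bx.
have x0 := le_lt_trans B0 Bx.
have L0 : line_integral f x = 0%E.
  apply/eqP; rewrite eq_le line_integral_ge0 andbT.
  have : ((pi^-1)%:E * line_integral f x <= 0)%E.
    by rewrite -tf; apply: ereal_sup_ubound; exists x.
  by rewrite lee_pdivrMl ?pi_gt0 // mule0.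
have := continuous_integral_eq0 (normc_sqr_continuous hf x0) (fun y => sqr_ge0 _) L0 y.
by move=> /eqP; rewrite sqrf_eq0 => /eqP/ComplexField.Normc.eq0_normc.
Qed.

End H2_functions.

(** * Limits of norms and the exclusion of scrambled sets *)

Lemma limn_einf_ge (R : realType) (u : nat -> \bar R) (c : \bar R) :
  (forall n, c <= u n)%E -> (c <= limn_einf u)%E.
Proof.
move=> cu; rewrite limn_einf_lim; apply: lime_ge; first exact: is_cvg_einfs.
by apply: nearW => n; apply: le_ereal_inf_tmp => _ [m _ <-].
Qed.

Lemma limn_einf_esup_nonincreasing (R : realType) (u : nat -> R) :
  (forall n, 0 <= u n) -> (forall n, u n.+1 <= u n) ->
  limn_einf (EFin \o u) = limn_esup (EFin \o u).
Proof.
move=> u0 /nonincreasing_seqP ndu.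
have cu : cvgn u.
  by apply: nonincreasing_is_cvgn => //; exists 0 => _ [n _ <-].
have ecu : (EFin \o u) @ \oo --> (limn u)%:E by apply: cvg_EFin => //; apply: nearW.
by have [-> ->] := cvg_limn_einf_sup ecu.
Qed.

(** Members of [in_H2] are total functions on [R[i]]; the norm sees only their values on the
    half-plane, so [f] itself may be nonzero. *)
Lemma h2_sqnorm_eq0 (R : realType) (f : R[i] -> R[i]) :
  (forall w, rhp w -> f w = 0) -> h2_sqnorm f = 0%E.
Proof.
move=> f0; apply/eqP; rewrite eq_le h2_sqnorm_tail tail_sqnorm_ge0 andbT.
apply: ge_ereal_sup => _ [x /= x0 <-].
rewrite /line_integral integral0_eq ?mule0 // => y _.
by rewrite /normc_sqr f0 // ComplexField.Normc.normc0 expr0n.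
Qed.

Lemma tail_sqnorm_fin_num (R : realType) (f : R[i] -> R[i]) (B : R) :
  in_H2 f -> 0 <= B -> tail_sqnorm f B \is a fin_num.
Proof.
move=> [_ ff] B0; rewrite ge0_fin_numE ?tail_sqnorm_ge0 //.
exact: le_lt_trans (tail_sqnorm_anti f B0) ff.
Qed.

Lemma fine_tail_sqnorm_gt0 (R : realType) (f : R[i] -> R[i]) (B : R) :
  in_H2 f -> 0 <= B -> tail_sqnorm f B != 0%E -> 0 < fine (tail_sqnorm f B).
Proof.
move=> fH B0 fN0; apply: fine_gt0.
by rewrite lt0e fN0 tail_sqnorm_ge0 ltey_eq tail_sqnorm_fin_num.
Qed.

Theorem theorem5p1 (R : realType) (a : R) (b : R[i]) :
  0 < a -> 0 <= complex.Re b ->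
  ~ li_yorke_chaotic (@in_H2 R) (@h2_norm R)
      (comp_op (fun w : R[i] => (Complex a 0) * w + b)).
Proof.
move=> a0 b0 [S [SH [Suncountable SLY]]].
set T := comp_op _ in SLY; set p := complex.Re b in b0.
(* A set without two distinct points is empty or a singleton, hence countable. *)
have [x [y [Sx Sy xy]]] : exists x y, [/\ S x, S y & x <> y].
  apply: contrapT => Sxy; apply: Suncountable.
  have [->|/set0P[x Sx]] := eqVneq S set0; first exact: countable0.
  apply: (@sub_countable _ _ _ [set x]); last exact: countable1.
  apply: subset_card_le => y Sy; apply: contrapT => yx; apply: Sxy.
  by exists y, x.
pose g := x - y; pose u n := h2_norm (iter n T g).
have gH : in_H2 g by apply: in_H2B; exact: SH.
have TH n : in_H2 (iter n T g) by exact: in_H2_iter.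
have uE : (fun n => (h2_norm (iter n T x - iter n T y))%:E) = EFin \o u.
  by apply/funext => n; rewrite /u /= -(iter_compB a b n x y).
have [einf0 esup0] := SLY x y Sx Sy xy; rewrite uE in einf0 esup0.
have fin n : h2_sqnorm (iter n T g) \is a fin_num.
  exact: tail_sqnorm_fin_num (TH n) (lexx 0).
have not_nonincreasing : ~ forall n, u n.+1 <= u n.
  move=> u_anti; move: esup0.
  rewrite -limn_einf_esup_nonincreasing // => [|n]; last exact: sqrtr_ge0.
  by rewrite einf0 ltxx.
have [a1|a1] := leP 1 a.
  (* Two effects shrink the norm: the factor [a^-1 <= 1], and the passage from the tail at 0 to the
     tail at [p >= 0]. *)
  apply: not_nonincreasing => n.
  have [hn _] := TH n.
  have le_sq : (h2_sqnorm (iter n.+1 T g) <= h2_sqnorm (iter n T g))%E.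
    rewrite !h2_sqnorm_tail iterS (tail_sqnorm_comp a0 hn) mulr0 add0r //.
    apply: (@le_trans _ _ (tail_sqnorm (iter n T g) p)); last exact: tail_sqnorm_anti.
    rewrite -[leRHS]mul1e lee_wpmul2r ?tail_sqnorm_ge0 // lee_fin.
    by rewrite invf_le1.
  have fine_sq := fine_le (fin n.+1) (fin n) le_sq.
  exact: (ler_wsqrtr fine_sq).
pose B := p / (1 - a).
have B0 : 0 <= B by rewrite divr_ge0 // subr_ge0 ltW.
have BE : a * B + p = B.
  by rewrite /B; field; rewrite subr_eq0 eq_sym lt_eqF.
(* If the tail is 0, [g] vanishes on the half-plane, though possibly not outside it. The
   contradiction therefore comes from the positive limit superior, not from [x <> y]. *)
have [tg0|tgN0] := eqVneq (tail_sqnorm g B) 0%E.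
  have g0 := tail_sqnorm_eq0 gH B0 tg0.
  have Tg0 n w : rhp w -> iter n T g w = 0.
    by elim: n w => [w /g0//|n ih w /(affine_rhp a0 b0)]; exact: ih.
  have u0 n : u n = 0 by rewrite /u /h2_norm h2_sqnorm_eq0 ?sqrtr0 //; exact: Tg0.
  by apply: not_nonincreasing => n; rewrite !u0.
have tg_fin := tail_sqnorm_fin_num gH B0.
have tg_gt0 := fine_tail_sqnorm_gt0 gH B0 tgN0.
(* As [B] is fixed by [a * B + p = B], each application of [T] multiplies this tail by
   [a^-1 > 1]. *)
have tail_le n : (tail_sqnorm g B <= tail_sqnorm (iter n T g) B)%E.
  elim: n => // n ih; apply: le_trans ih _; have [hn _] := TH n.
  rewrite iterS (tail_sqnorm_comp a0 hn) BE // -[leLHS]mul1e lee_wpmul2r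
    ?tail_sqnorm_ge0 // lee_fin.
  by rewrite invf_ge1 // ltW.
have u_ge n : ((Num.sqrt (fine (tail_sqnorm g B)))%:E <= (u n)%:E)%E.
  have le_sq : (tail_sqnorm g B <= h2_sqnorm (iter n T g))%E.
    exact: le_trans (tail_le n) (tail_sqnorm_anti _ B0).
  have fine_sq := fine_le tg_fin (fin n) le_sq.
  by rewrite lee_fin; exact: (ler_wsqrtr fine_sq).
have := limn_einf_ge u_ge; rewrite einf0 lee_fin leNgt sqrtr_gt0.
by rewrite tg_gt0.
Qed.
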